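(* Let $F \subseteq E$ be a field extension and let $\mathfrak{g}$ be a Lie algebra over $E$ which is defined over the subfield $F$. Then every Lie algebra $\mathfrak{h}$ over $E$ which is conjugate over $F$ to $\mathfrak{g}$ is isomorphic to $\mathfrak{g}$ as a Lie algebra over $E$.
   Context: A Lie algebra $\mathfrak{g}$ over $E$ is defined over $F$ if there is a Lie algebra $\mathfrak{m}$ over $F$ with $\mathfrak{g} \cong \mathfrak{m} \otimes_F E$ as Lie algebras over $E$. $\mathrm{Aut}(E,F)$ is the group of field automorphisms of $E$ fixing $F$ pointwise. For a field automorphism $\sigma$ of $E$, a map $\varphi: V \to W$ between $E$-vector spaces is $\sigma$-linear if $\varphi(\lambda v + \mu w) = \sigma(\lambda)\varphi(v) + \sigma(\mu)\varphi(w)$ for all $v,w \in V$, $\lambda,\mu \in E$; a $\sigma$-isomorphism of Lie algebras over $E$ is a bijective $\sigma$-linear map preserving the Lie bracket. $\mathfrak{g}$ and $\mathfrak{h}$ are conjugate over $F$ if there exist $\sigma \in \mathrm{Aut}(E,F)$ and a $\sigma$-isomorphism of Lie algebras $\mathfrak{g} \to \mathfrak{h}$. *)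

(* Defs.v *)
From HB Require Import structures.
From mathcomp Require Import all_boot all_algebra.
From mathcomp Require Import boolp.
From mathcomp Require Import freeg.

Set Implicit Arguments.
Unset Strict Implicit.
Unset Printing Implicit Defensive.
Set Warnings "-redundant-canonical-projection".

Import GRing.Theory.

Local Open Scope ring_scope.
Local Open Scope quotient_scope.

(* Lie algebras of arbitrary, possibly infinite, dimension and over a field of
   arbitrary characteristic: the bracket is required to be alternating. *)
HB.mixin Record Lmodule_isLieAlgebra (K : fieldType) (L : Type)
    of GRing.Lmodule K L := {
  lie : L -> L -> L;
  lieDl : forall x y z, lie (x + y) z = lie x z + lie y z;
  lieDr : forall x y z, lie x (y + z) = lie x y + lie x z;
  lieZl : forall (c : K) x y, lie (c *: x) y = c *: lie x y;
  lieZr : forall (c : K) x y, lie x (c *: y) = c *: lie x y;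
  lie_alt : forall x, lie x x = 0;
  lie_jacobi : forall x y z,
    lie x (lie y z) + lie y (lie z x) + lie z (lie x y) = 0
}.

#[short(type="lieAlgType")]
HB.structure Definition LieAlgebra (K : fieldType) :=
  { L of Lmodule_isLieAlgebra K L & GRing.Lmodule K L }.

Section BaseChange.

Variables (F E : fieldType) (iota : {rmorphism F -> E}).

Section Module.

Variable M : lmodType F.

(* The subgroup of the free abelian group on M * E generated by the defining
   relations of M (x)_F E, where F acts on E through iota. *)
Inductive tensor_rel : {freeg (M * E)%type} -> Prop :=
| tensor_rel0 : tensor_rel 0
| tensor_relB D1 D2 : tensor_rel D1 -> tensor_rel D2 -> tensor_rel (D1 - D2)
| tensor_relDl x y a :
    tensor_rel (<< (x + y, a) >> - << (x, a) >> - << (y, a) >>)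
| tensor_relDr x a b :
    tensor_rel (<< (x, a + b) >> - << (x, a) >> - << (x, b) >>)
| tensor_relZ c x a :
    tensor_rel (<< (c *: x, a) >> - << (x, iota c * a) >>).

Definition tensor_relb : {pred {freeg (M * E)%type}} :=
  fun D => `[< tensor_rel D >].

Fact tensor_relb_zmod_closed : zmod_closed tensor_relb.
Proof.
split=> [|D1 D2]; first exact/asboolP/tensor_rel0.
by move=> /asboolP h1 /asboolP h2; apply/asboolP/tensor_relB.
Qed.
HB.instance Definition _ :=
  GRing.isZmodClosed.Build _ tensor_relb tensor_relb_zmod_closed.

(* M (x)_F E *)
Definition base_change : Type := Quotient.quot tensor_relb.
HB.instance Definition _ := GRing.Zmodule.copy base_change (Quotient.quot tensor_relb).

(* The pure tensor x (x) a *)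
Definition tensor (x : M) (a : E) : base_change :=
  \pi_(Quotient.quot tensor_relb) << (x, a) >>.

Definition balanced (A : zmodType) (f : M -> E -> A) :=
  [/\ forall x y a, f (x + y) a = f x a + f y a,
      forall x a b, f x (a + b) = f x a + f x b
    & forall c x a, f (c *: x) a = f x (iota c * a)].

(* The additive map x (x) a |-> f x a, meaningful when f is balanced *)
Definition base_change_lift (A : zmodType) (f : M -> E -> A)
    (u : base_change) : A :=
  fglift (fun p : M * E => f p.1 p.2 : zmodule A)
         (repr (u : Quotient.quot tensor_relb)).

Local Notation piT := (\pi_(Quotient.quot tensor_relb)).

Lemma piT_eq D1 D2 : piT D1 = piT D2 <-> tensor_rel (D1 - D2).
Proof.
split=> [/eqP|h]; first by rewrite -Quotient.idealrBE => /asboolP.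
by apply/eqP; rewrite -Quotient.idealrBE; apply/asboolP.
Qed.

Lemma piTB D1 D2 : piT (D1 - D2) = piT D1 - piT D2.
Proof. exact: raddfB. Qed.

Lemma piT0 : piT 0 = 0.
Proof. exact: raddf0. Qed.

Lemma piTD D1 D2 : piT (D1 + D2) = piT D1 + piT D2.
Proof. exact: raddfD. Qed.

Lemma tensor_balanced : balanced tensor.
Proof.
split=> [x y a|x a b|c x a].
- apply/eqP; rewrite -subr_eq0 opprD addrA -!piTB -[X in _ == X]piT0.
  by apply/eqP/piT_eq; rewrite subr0; apply: tensor_relDl.
- apply/eqP; rewrite -subr_eq0 opprD addrA -!piTB -[X in _ == X]piT0.
  by apply/eqP/piT_eq; rewrite subr0; apply: tensor_relDr.
- by apply/piT_eq/tensor_relZ.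
Qed.

Lemma tensorDl x y a : tensor (x + y) a = tensor x a + tensor y a.
Proof. by have [] := tensor_balanced. Qed.

Lemma tensorDr x a b : tensor x (a + b) = tensor x a + tensor x b.
Proof. by have [] := tensor_balanced. Qed.

Lemma tensorZl c x a : tensor (c *: x) a = tensor x (iota c * a).
Proof. by have [] := tensor_balanced. Qed.

Lemma tensor0l a : tensor 0 a = 0.
Proof. by apply: (addrI (tensor 0 a)); rewrite -tensorDl !addr0. Qed.

Lemma tensorNl x a : tensor (- x) a = - tensor x a.
Proof. by apply/eqP; rewrite -addr_eq0 -tensorDl addNr tensor0l. Qed.

Lemma base_change_ind (P : base_change -> Prop) :
    (forall x a, P (tensor x a)) ->
    (forall u v, P u -> P v -> P (u + v)) ->
  forall u, P u.
Proof.
move=> Pt PD u; rewrite -[u]reprK; move: (repr u) => D {u}.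
have P0 : P 0 by rewrite -(tensor0l 0); apply: Pt.
have PMn n x a : P (tensor x a *+ n).
  by elim: n => [|n IH]; rewrite ?mulr0n // mulrS; apply: PD.
elim/freeg_ind_dom0: D => [|k [x a] D _ _ IH]; first by rewrite piT0.
rewrite piTD; apply: PD => //.
have -> : << k *g (x, a) >> = << (x, a) >> *~ k :> {freeg (M * E)%type}.
  by rewrite freegU_mulz intz.
have piTMn n : piT (<< (x, a) >> *+ n) = tensor x a *+ n.
  by elim: n => [|n IHn]; rewrite ?mulr0n ?piT0 // !mulrS piTD IHn.
case: k => n; first by rewrite -pmulrn piTMn; apply: PMn.
rewrite NegzE mulrNz -pmulrn -sub0r piTB piT0 sub0r piTMn -mulNrn -tensorNl.
exact: PMn.
Qed.

Section Lift.

Variables (A : zmodType) (f : M -> E -> A).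
Hypothesis fb : balanced f.

Let fl : {freeg (M * E)%type} -> zmodule A :=
  fglift (fun p : M * E => f p.1 p.2 : zmodule A).

Let flB D1 D2 : fl (D1 - D2) = fl D1 - fl D2.
Proof. exact: lift_is_additive. Qed.

Let flU x a : fl << (x, a) >> = f x a.
Proof. by rewrite /fl liftU scale1r. Qed.

Let fl_rel D : tensor_rel D -> fl D = 0.
Proof.
have [fDl fDr fZ] := fb; elim=> {D} [|D1 D2 _ h1 _ h2|x y a|x a b|c x a].
- by rewrite -(subrr 0) flB subrr.
- by rewrite flB h1 h2 subrr.
- by rewrite !flB !flU fDl addrAC addrK subrr.
- by rewrite !flB !flU fDr addrAC addrK subrr.
- by rewrite flB !flU fZ subrr.
Qed.

Let lift_pi D : base_change_lift f (piT D) = fl D.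
Proof.
apply/eqP; rewrite /base_change_lift -subr_eq0; apply/eqP.
rewrite -[LHS]/(fl (repr (piT D)) - fl D) -flB; apply: fl_rel.
by apply/piT_eq; rewrite reprK.
Qed.

Lemma base_change_lift_tensor x a : base_change_lift f (tensor x a) = f x a.
Proof. by rewrite lift_pi flU. Qed.

Lemma base_change_liftB u v :
  base_change_lift f (u - v) = base_change_lift f u - base_change_lift f v.
Proof.
rewrite -[u]reprK -[v]reprK.
by rewrite -[X in base_change_lift f X]piTB !lift_pi flB.
Qed.

Lemma base_change_lift0 : base_change_lift f 0 = 0.
Proof. by have := base_change_liftB 0 0; rewrite !subrr. Qed.

Lemma base_change_liftD u v :
  base_change_lift f (u + v) = base_change_lift f u + base_change_lift f v.
Proof.
have liftN w : base_change_lift f (- w) = - base_change_lift f w.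
  by have := base_change_liftB 0 w; rewrite !sub0r base_change_lift0 sub0r.
by have := base_change_liftB u (- v); rewrite liftN !opprK.
Qed.

End Lift.

(* b . (x (x) a) = x (x) (b a) *)
Definition base_change_scale (b : E) : base_change -> base_change :=
  base_change_lift (fun x a => tensor x (b * a)).

Fact scale_balanced b : balanced (fun x a => tensor x (b * a)).
Proof.
split=> [x y a|x a c|c x a]; first exact: tensorDl.
- by rewrite mulrDr tensorDr.
- by rewrite tensorZl mulrCA.
Qed.

Let scaleD b : {morph base_change_scale b : u v / u + v}.
Proof. by move=> u v; exact: (base_change_liftD (scale_balanced b)). Qed.

Let scaleT b x a : base_change_scale b (tensor x a) = tensor x (b * a).
Proof. exact: (base_change_lift_tensor (scale_balanced b)). Qed.

Fact base_change_scaleA a b u :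
  base_change_scale a (base_change_scale b u) = base_change_scale (a * b) u.
Proof.
elim/base_change_ind: u => [x c|u v IHu IHv]; first by rewrite !scaleT mulrA.
by rewrite !scaleD IHu IHv.
Qed.

Fact base_change_scale1 : left_id 1 base_change_scale.
Proof.
elim/base_change_ind=> [x c|u v IHu IHv]; first by rewrite scaleT mul1r.
by rewrite scaleD IHu IHv.
Qed.

Fact base_change_scaleDr : right_distributive base_change_scale +%R.
Proof. by move=> b u v; exact: scaleD. Qed.

Fact base_change_scaleDl u :
  {morph base_change_scale^~ u : a b / a + b}.
Proof.
move=> a b /=; elim/base_change_ind: u => [x c|u v IHu IHv].
  by rewrite !scaleT mulrDl tensorDr.
by rewrite !scaleD IHu IHv addrACA.
Qed.

HB.instance Definition _ := GRing.Zmodule_isLmodule.Build E base_change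
  base_change_scaleA base_change_scale1 base_change_scaleDr
  base_change_scaleDl.

Lemma scale_tensor (b : E) x a : b *: tensor x a = tensor x (b * a).
Proof. exact: scaleT. Qed.

End Module.

Variable m : lieAlgType F.

(* [x (x) a, y (x) b] = [x, y] (x) (a b) *)
Definition base_change_lie (u v : base_change m) : base_change m :=
  base_change_lift (fun x a =>
    base_change_lift (fun y b => tensor (lie x y) (a * b)) v) u.

Let inner_balanced (x : m) a :
  balanced (fun y b => tensor (lie x y) (a * b) : base_change m).
Proof.
split=> [y z b|y b c|c y b]; first by rewrite lieDr tensorDl.
- by rewrite mulrDr tensorDr.
- by rewrite lieZr tensorZl mulrCA.
Qed.

Let outer_balanced (v : base_change m) : balanced (fun x a =>
  base_change_lift (fun y b => tensor (lie x y) (a * b) : base_change m) v).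
Proof.
split=> [x y a|x a b|c x a]; elim/base_change_ind: v => [z d|u v IHu IHv];
  do ?[by rewrite !(base_change_liftD (inner_balanced _ _)) IHu IHv // addrACA];
  rewrite !(base_change_lift_tensor (inner_balanced _ _)).
- by rewrite lieDl tensorDl.
- by rewrite mulrDl tensorDr.
- by rewrite lieZl tensorZl mulrA.
Qed.

Lemma base_change_lie_tensor x a y b :
  base_change_lie (tensor x a) (tensor y b) = tensor (lie x y) (a * b).
Proof.
rewrite /base_change_lie (base_change_lift_tensor (outer_balanced _)).
exact: (base_change_lift_tensor (inner_balanced _ _)).
Qed.

Fact base_change_lieDl u v w :
  base_change_lie (u + v) w = base_change_lie u w + base_change_lie v w.
Proof. exact: (base_change_liftD (outer_balanced w)). Qed.

Fact base_change_lieDr u v w :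
  base_change_lie u (v + w) = base_change_lie u v + base_change_lie u w.
Proof.
elim/base_change_ind: u => [x a|u1 u2 IH1 IH2]; last first.
  by rewrite !base_change_lieDl IH1 IH2 addrACA.
rewrite /base_change_lie !(base_change_lift_tensor (outer_balanced _)).
exact: (base_change_liftD (inner_balanced _ _)).
Qed.

Fact base_change_lieZl (c : E) u v :
  base_change_lie (c *: u) v = c *: base_change_lie u v.
Proof.
elim/base_change_ind: u => [x a|u1 u2 IH1 IH2]; last first.
  by rewrite scalerDr !base_change_lieDl IH1 IH2 scalerDr.
elim/base_change_ind: v => [y b|v1 v2 IH1 IH2]; last first.
  by rewrite !base_change_lieDr IH1 IH2 scalerDr.
by rewrite scale_tensor !base_change_lie_tensor scale_tensor mulrA.
Qed.

Fact base_change_lieZr (c : E) u v :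
  base_change_lie u (c *: v) = c *: base_change_lie u v.
Proof.
elim/base_change_ind: u => [x a|u1 u2 IH1 IH2]; last first.
  by rewrite !base_change_lieDl IH1 IH2 scalerDr.
elim/base_change_ind: v => [y b|v1 v2 IH1 IH2]; last first.
  by rewrite scalerDr !base_change_lieDr IH1 IH2 scalerDr.
by rewrite scale_tensor !base_change_lie_tensor scale_tensor mulrCA.
Qed.

Let lie_skew (x y : m) : lie x y + lie y x = 0.
Proof. by have := lie_alt (x + y); rewrite lieDl !lieDr !lie_alt add0r addr0. Qed.

Fact base_change_lie_skew u v : base_change_lie u v + base_change_lie v u = 0.
Proof.
elim/base_change_ind: u => [x a|u1 u2 IH1 IH2]; last first.
  by rewrite base_change_lieDl base_change_lieDr addrACA IH1 IH2 addr0.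
elim/base_change_ind: v => [y b|v1 v2 IH1 IH2]; last first.
  by rewrite base_change_lieDl base_change_lieDr addrACA IH1 IH2 addr0.
by rewrite !base_change_lie_tensor [b * a]mulrC -tensorDl lie_skew tensor0l.
Qed.

Fact base_change_lie_alt u : base_change_lie u u = 0.
Proof.
elim/base_change_ind: u => [x a|u v IHu IHv].
  by rewrite base_change_lie_tensor lie_alt tensor0l.
rewrite base_change_lieDl !base_change_lieDr IHu IHv add0r addr0.
exact: base_change_lie_skew.
Qed.

Fact base_change_lie_jacobi u v w :
  base_change_lie u (base_change_lie v w)
  + base_change_lie v (base_change_lie w u)
  + base_change_lie w (base_change_lie u v) = 0.
Proof.
have E3 (p1 p2 q1 q2 r1 r2 : base_change m) :
    (p1 + p2) + (q1 + q2) + (r1 + r2) = (p1 + q1 + r1) + (p2 + q2 + r2).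
  by rewrite [p1 + p2 + (q1 + q2)]addrACA [LHS]addrACA.
elim/base_change_ind: u => [x a|u1 u2 IH1 IH2]; last first.
  by rewrite !(base_change_lieDl, base_change_lieDr) E3 IH1 IH2 addr0.
elim/base_change_ind: v => [y b|v1 v2 IH1 IH2]; last first.
  by rewrite !(base_change_lieDl, base_change_lieDr) E3 IH1 IH2 addr0.
elim/base_change_ind: w => [z c|w1 w2 IH1 IH2]; last first.
  by rewrite !(base_change_lieDl, base_change_lieDr) E3 IH1 IH2 addr0.
rewrite !base_change_lie_tensor.
rewrite (_ : b * (c * a) = a * (b * c)); last by rewrite mulrA mulrC.
rewrite (_ : c * (a * b) = a * (b * c)); last by rewrite mulrC mulrA.
by rewrite -!tensorDl lie_jacobi tensor0l.
Qed.

HB.instance Definition _ := Lmodule_isLieAlgebra.Build E (base_change m)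
  base_change_lieDl base_change_lieDr base_change_lieZl base_change_lieZr
  base_change_lie_alt base_change_lie_jacobi.

End BaseChange.

Definition lie_isomorphic (E : fieldType) (g h : lieAlgType E) : Prop :=
  exists phi : {linear g -> h},
    bijective phi /\ (forall x y, phi (lie x y) = lie (phi x) (phi y)).

Definition defined_over (F E : fieldType) (iota : {rmorphism F -> E})
    (g : lieAlgType E) : Prop :=
  exists m : lieAlgType F, lie_isomorphic g (base_change iota m).

(* sigma belongs to Aut(E,F), F being embedded in E by iota *)
Definition field_aut_over (F E : fieldType) (iota : {rmorphism F -> E})
    (sigma : {rmorphism E -> E}) : Prop :=
  bijective sigma /\ (forall c : F, sigma (iota c) = iota c).

Definition sigma_linear (E : fieldType) (sigma : E -> E) (V W : lmodType E)
    (phi : V -> W) : Prop :=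
  forall (lambda mu : E) (v w : V),
    phi (lambda *: v + mu *: w) = sigma lambda *: phi v + sigma mu *: phi w.

Definition sigma_isomorphism (E : fieldType) (sigma : E -> E)
    (g h : lieAlgType E) (phi : g -> h) : Prop :=
  [/\ bijective phi, sigma_linear sigma phi
    & forall x y, phi (lie x y) = lie (phi x) (phi y)].

Definition conjugate_over (F E : fieldType) (iota : {rmorphism F -> E})
    (g h : lieAlgType E) : Prop :=
  exists sigma : {rmorphism E -> E}, field_aut_over iota sigma /\
    exists phi : g -> h, sigma_isomorphism sigma phi.

(* Main.v *)
Require Import Defs.
From HB Require Import structures.
From mathcomp Require Import all_boot all_algebra.

(** If [phi : h -> g] is [sigma^-1]-linear and [g] is [m (x)_F E], then
    composing [phi] with the [sigma]-isomorphism [1 (x) sigma] of [m (x)_F E]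
    cancels the twist, leaving an [E]-linear isomorphism [h -> g]. *)

Set Implicit Arguments.
Unset Strict Implicit.
Unset Printing Implicit Defensive.

Import GRing.Theory.
Local Open Scope ring_scope.

Section SigmaIsomorphism.

Variable E : fieldType.
Implicit Types g h k : lieAlgType E.

Lemma sigma_isomorphism_comp (sigma tau : E -> E) g h k
    (phi : g -> h) (psi : h -> k) :
    sigma_isomorphism sigma phi -> sigma_isomorphism tau psi ->
  sigma_isomorphism (tau \o sigma) (psi \o phi).
Proof.
move=> [phi_bij phi_lin phi_lie] [psi_bij psi_lin psi_lie]; split.
- exact: bij_comp.
- by move=> a b v w; rewrite /= phi_lin psi_lin.
- by move=> x y; rewrite /= phi_lie psi_lie.
Qed.

(** Since [phi] is injective, each identity for [psi] may be checked after applying [phi], where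
    [psi] and [tau] both cancel. *)
Lemma sigma_isomorphism_inv (sigma tau : E -> E) g h (phi : g -> h)
    (psi : h -> g) :
    cancel tau sigma -> cancel phi psi -> cancel psi phi ->
  sigma_isomorphism sigma phi -> sigma_isomorphism tau psi.
Proof.
move=> tauK phiK psiK [_ phi_lin phi_lie]; split; first by exists phi.
- by move=> a b v w; apply: (can_inj phiK); rewrite phi_lin !psiK !tauK.
- by move=> x y; apply: (can_inj phiK); rewrite phi_lie !psiK.
Qed.

(** Treats ordinary isomorphisms as the twist [id], so that they compose with twisted ones. *)
Lemma lie_isomorphicP g h :
  lie_isomorphic g h <-> exists phi : g -> h, sigma_isomorphism id phi.
Proof.
split=> [[phi [phi_bij phi_lie]]|[phi [phi_bij phi_lin phi_lie]]].
  by exists phi; split=> // a b v w; rewrite linearD !linearZ.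
have phi_linear : linear phi.
  by move=> a v w; have := phi_lin a 1 v w; rewrite !scale1r.
pose phiL : {linear g -> h} :=
  HB.pack phi (GRing.isLinear.Build _ _ _ _ phi phi_linear).
by exists phiL.
Qed.

End SigmaIsomorphism.

Section BaseChangeMap.

Variables (F E : fieldType) (iota : {rmorphism F -> E}) (M : lmodType F).

(** This is [1 (x) s]. A bare function [s] is taken so that the inverse of an automorphism, supplied
    by [bijective] without any structure, is also allowed. *)
Definition base_change_map (s : E -> E) : base_change iota M -> base_change iota M :=
  base_change_lift (fun x a => tensor iota x (s a)).

Section AdditiveMap.

Variable s : E -> E.
Hypothesis sD : {morph s : a b / a + b}.
Hypothesis sZ : forall c a, s (iota c * a) = iota c * s a.

(** [F]-linearity of [s] lets it commute with moving scalars of [F] across the tensor sign. *)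
Let s_balanced : balanced iota (fun (x : M) a => tensor iota x (s a)).
Proof.
split=> [x y a|x a b|c x a]; first exact: tensorDl.
- by rewrite sD tensorDr.
- by rewrite tensorZl sZ.
Qed.

Lemma base_change_map_tensor x a :
  base_change_map s (tensor iota x a) = tensor iota x (s a).
Proof. exact: (base_change_lift_tensor s_balanced). Qed.

Lemma base_change_mapD : {morph base_change_map s : u v / u + v}.
Proof. by move=> u v; exact: (base_change_liftD s_balanced). Qed.

End AdditiveMap.

Lemma base_change_mapK (s t : E -> E) :
    {morph s : a b / a + b} -> (forall c a, s (iota c * a) = iota c * s a) ->
    {morph t : a b / a + b} -> (forall c a, t (iota c * a) = iota c * t a) ->
  cancel s t -> cancel (base_change_map s) (base_change_map t).
Proof.
move=> sD sZ tD tZ sK; elim/base_change_ind=> [x a|u v IHu IHv].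
  by rewrite !base_change_map_tensor // sK.
by rewrite !base_change_mapD // IHu IHv.
Qed.

End BaseChangeMap.

(** Fixing [F] makes [1 (x) sigma] well defined; multiplicativity of [sigma] gives both the twist on
    scalars and compatibility with brackets, by a check on pure tensors. *)
Lemma base_change_map_sigma_isomorphism (F E : fieldType)
    (iota : {rmorphism F -> E}) (m : lieAlgType F)
    (sigma : {rmorphism E -> E}) :
    field_aut_over iota sigma ->
  sigma_isomorphism sigma (@base_change_map F E iota m sigma).
Proof.
move=> [[tau sigmaK tauK] sigma_iota].
have sD := rmorphD sigma.
have sZ c a : sigma (iota c * a) = iota c * sigma a.
  by rewrite rmorphM sigma_iota.
(* [tau] is only a set-theoretic inverse, so its [F]-linearity is pulled back along the injective
   [sigma]. *)
have tD : {morph tau : a b / a + b}.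
  by move=> a b; apply: (can_inj sigmaK); rewrite rmorphD !tauK.
have tZ c a : tau (iota c * a) = iota c * tau a.
  by apply: (can_inj sigmaK); rewrite sZ !tauK.
have mapD := @base_change_mapD _ _ iota m _ sD sZ.
have mapT := @base_change_map_tensor _ _ iota m _ sD sZ.
have mapZ c u : base_change_map sigma (c *: u)
    = sigma c *: base_change_map sigma u :> base_change iota m.
  elim/base_change_ind: u => [x a|u v IHu IHv].
    by rewrite scale_tensor !mapT scale_tensor rmorphM.
  by rewrite scalerDr !mapD IHu IHv scalerDr.
split.
- by exists (base_change_map tau); apply: base_change_mapK.
- by move=> a b u v; rewrite mapD !mapZ.
move=> u v; elim/base_change_ind: u => [x a|u1 u2 IH1 IH2]; last first.
  by rewrite lieDl !mapD IH1 IH2 lieDl.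
elim/base_change_ind: v => [y b|v1 v2 IH1 IH2]; last first.
  by rewrite lieDr !mapD IH1 IH2 lieDr.
(* The [lie] of the structure on [base_change iota m] is [base_change_lie] by conversion. *)
have lieT z c t d : lie (tensor iota z c) (tensor iota t d)
    = tensor iota (lie z t) (c * d) :> base_change iota m.
  exact: base_change_lie_tensor.
by rewrite lieT !mapT lieT rmorphM.
Qed.

Theorem proposition3p12 (F E : fieldType) (iota : {rmorphism F -> E})
    (g : lieAlgType E) (g_def : defined_over iota g)
    (h : lieAlgType E) (gh_conj : conjugate_over iota g h) :
  lie_isomorphic h g.
Proof.
have [m /lie_isomorphicP[psi psi_iso]] := g_def.
have [sigma [sigma_aut [phi phi_iso]]] := gh_conj.
have [[tau sigmaK tauK] _] := sigma_aut.
have [[phi' phiK phi'K] _ _] := phi_iso.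
have [[psi' psiK psi'K] _ _] := psi_iso.
have phi'_iso := sigma_isomorphism_inv tauK phiK phi'K phi_iso.
have psi'_iso : sigma_isomorphism id psi'.
  by apply: sigma_isomorphism_inv psiK psi'K psi_iso.
(* The composite runs from [h] to [g], twice through [base_change iota m], then back to [g], with
   twists [tau], [id], [sigma], [id]. *)
have [bij lin mor] := sigma_isomorphism_comp
  (sigma_isomorphism_comp (sigma_isomorphism_comp phi'_iso psi_iso)
     (base_change_map_sigma_isomorphism m sigma_aut)) psi'_iso.
apply/lie_isomorphicP; eexists; split; [exact: bij | | exact: mor].
(* The total twist [sigma \o tau] is the identity only pointwise, so linearity is rederived. *)
by move=> a b v w; rewrite lin /= !tauK.
Qed.
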